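(* Let $k$ be a field of characteristic zero, let $K\supseteq k$ be a field extension of finite degree, let $\mathfrak{g}_k$ be a finite-dimensional Lie algebra over $k$, and let $\mathfrak{g}_K=K\otimes_k\mathfrak{g}_k$ be the Lie algebra over $K$ obtained by extension of scalars. If $\mathrm{AID}(\mathfrak{g}_K)\neq\mathrm{Inn}(\mathfrak{g}_K)$, then also $\mathrm{AID}(\mathfrak{g}_k)\neq\mathrm{Inn}(\mathfrak{g}_k)$.
   Context: For a finite-dimensional Lie algebra $\mathfrak{g}$ over a field $F$, let $\mathrm{Inn}(\mathfrak{g})=\{\mathrm{ad}(x)\mid x\in\mathfrak{g}\}$ be the inner derivations. An ($F$-linear) derivation $D$ of $\mathfrak{g}$ is called almost inner if $D(x)\in[\mathfrak{g},x]=\{[y,x]\mid y\in\mathfrak{g}\}$ for all $x\in\mathfrak{g}$. The space of almost inner derivations is denoted $\mathrm{AID}(\mathfrak{g})$. *)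

(* Defs.v *)
From HB Require Import structures.
From mathcomp Require Import all_boot all_algebra all_field.
From mathcomp Require Import boolp classical_sets.

Set Implicit Arguments.
Unset Strict Implicit.
Unset Printing Implicit Defensive.

Import GRing.Theory.
Local Open Scope ring_scope.

HB.mixin Record Lmodule_isLieAlgebra (F : fieldType) L of GRing.Lmodule F L := {
  bracket : L -> L -> L;
  bracket_linear_l : forall y, linear (bracket^~ y);
  bracket_linear_r : forall x, linear (bracket x);
  bracketxx : forall x, bracket x x = 0;
  bracket_jacobi : forall x y z,
    bracket x (bracket y z) + bracket y (bracket z x)
      + bracket z (bracket x y) = 0 }.

#[short(type="lieAlgType")]
HB.structure Definition LieAlgebra (F : fieldType) :=
  {L of Vector F L & Lmodule_isLieAlgebra F L}.

HB.instance Definition _ (F : fieldType) (L : lieAlgType F) (x : L) :=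
  GRing.isLinear.Build F L L *:%R (bracket x) (bracket_linear_r x).

Section Derivations.
Variables (F : fieldType) (L : lieAlgType F).

Definition ad (x : L) : 'End(L) := linfun (bracket x).

Lemma adE x y : ad x y = bracket x y.
Proof. exact: lfunE. Qed.

Definition derivation (D : 'End(L)) : Prop :=
  forall x y, D (bracket x y) = bracket (D x) y + bracket x (D y).

Definition almost_inner (D : 'End(L)) : Prop :=
  forall x, exists y, D x = bracket y x.

Definition Inn : set 'End(L) := range ad.

Definition AID : set 'End(L) := [set D | derivation D /\ almost_inner D]%classic.

End Derivations.
Arguments Inn {F} L.
Arguments AID {F} L.

Section ScalarExtension.
Variables (k : fieldType) (K : fieldExtType k).

(* The K-vector space V', with pure tensors t a v, is K (x)_k V: V' is a
   k-vector space through k -> K, c |-> c%:A, and t is the universal k-bilinear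
   map on K * V. The K-action c (a (x) v) = (c a) (x) v is the linearity of
   t^~ v over K. *)
Record is_scalar_extension (V : lmodType k) (V' : lmodType K)
    (t : K -> V -> V') : Prop := IsScalarExtension {
  pure_linear_l : forall v (c a b : K), t (c * a + b) v = c *: t a v + t b v;
  pure_linear_r : forall a (c : k) v w,
    t a (c *: v + w) = c%:A *: t a v + t a w;
  pure_universal : forall (W : lmodType k) (f : K -> V -> W),
    (forall v, linear (f^~ v)) -> (forall a, linear (f a)) ->
    exists! h : V' -> W,
      (forall (c : k) u u', h (c%:A *: u + u') = c *: h u + h u') /\
      (forall a v, h (t a v) = f a v) }.

Record is_lie_scalar_extension (L : lieAlgType k) (L' : lieAlgType K)
    (t : K -> L -> L') : Prop := IsLieScalarExtension {
  lie_scalar_extension : is_scalar_extension t;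
  pure_bracket : forall a b x y,
    bracket (t a x) (t b y) = t (a * b) (bracket x y) }.

End ScalarExtension.

(* Scalar extensions exist: coordinates in a basis of L give a model. *)

Definition scalar_ext_coord (k : fieldType) (K : fieldExtType k)
  (L : lieAlgType k) : Type := 'rV[K]_(\dim {:L}).

Section Coordinates.
Variables (k : fieldType) (K : fieldExtType k) (L : lieAlgType k).
Local Notation M := (scalar_ext_coord K L).
Local Notation n := (\dim {:L}).
Local Notation e := (vbasis {:L}).

HB.instance Definition _ := Vector.copy M 'rV[K]_n.

Definition pure_coord (a : K) (x : L) : M :=
  \row_i (coord e i x *: a).

Definition bracket_coord (u v : M) : M :=
  \sum_i \sum_j ((u : 'rV_n) 0 i * (v : 'rV_n) 0 j)
    *: pure_coord 1 (bracket e`_i e`_j).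

Lemma pure_coord_linear_l x (c a b : K) :
  pure_coord (c * a + b) x = c *: pure_coord a x + pure_coord b x.
Proof. by apply/rowP => i; rewrite !mxE scalerDr scalerAr. Qed.

Lemma pure_coord_linear_r a (c : k) x y :
  pure_coord a (c *: x + y) = c%:A *: pure_coord a x + pure_coord a y.
Proof.
by apply/rowP => i; rewrite !mxE linearP scalerDl mulr_algl scalerA.
Qed.

Lemma pure_coordZ a x : pure_coord a x = a *: pure_coord 1 x.
Proof. by apply/rowP => i; rewrite !mxE -scalerAr mulr1. Qed.

Lemma pure_coord0 a : pure_coord a 0 = 0.
Proof. by apply/rowP => i; rewrite !mxE linear0 scale0r. Qed.

Lemma pure_coordD a x y :
  pure_coord a (x + y) = pure_coord a x + pure_coord a y.
Proof. by apply/rowP => i; rewrite !mxE linearD scalerDl. Qed.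

Lemma pure_coord_basis a (i : 'I_n) :
  pure_coord a e`_i = a *: (delta_mx 0 i : 'rV_n).
Proof.
apply/rowP => j; rewrite !mxE coord_free ?(basis_free (vbasisP _)) //.
by rewrite eqxx /= eq_sym; case: eqP => _; rewrite ?scale1r ?mulr1 ?scale0r ?mulr0.
Qed.

Lemma coord_decomp (u : M) : u = \sum_i pure_coord ((u : 'rV_n) 0 i) e`_i.
Proof.
rewrite [LHS](row_sum_delta (u : 'rV_n)).
by apply: eq_bigr => i _; rewrite pure_coord_basis.
Qed.

Lemma bracket_coord_linear_l v : linear (bracket_coord^~ v).
Proof.
move=> c u u'; rewrite /bracket_coord scaler_sumr -big_split; apply: eq_bigr => i _.
rewrite scaler_sumr -big_split; apply: eq_bigr => j _.
by rewrite !mxE mulrDl scalerDl scalerA mulrA.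
Qed.

Lemma bracket_coord_linear_r u : linear (bracket_coord u).
Proof.
move=> c v v'; rewrite /bracket_coord scaler_sumr -big_split; apply: eq_bigr => i _.
rewrite scaler_sumr -big_split; apply: eq_bigr => j _.
by rewrite !mxE mulrDr scalerDl scalerA mulrCA.
Qed.

HB.instance Definition _ u :=
  GRing.isLinear.Build K M M *:%R (bracket_coord u) (bracket_coord_linear_r u).

Lemma bracketDl (x y z : L) : bracket (x + y) z = bracket x z + bracket y z.
Proof. by have := bracket_linear_l z 1 x y; rewrite /= !scale1r. Qed.

Lemma bracketZl c (x z : L) : bracket (c *: x) z = c *: bracket x z.
Proof.
have b0 : bracket 0 z = 0.
  by apply: (addrI (bracket 0 z)); rewrite -bracketDl !addr0.
by have := bracket_linear_l z c x 0; rewrite /= b0 !addr0.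
Qed.

Lemma bracketZr c (x z : L) : bracket x (c *: z) = c *: bracket x z.
Proof. exact: (linearZ_LR (bracket x)). Qed.

Lemma bracketC (x y : L) : bracket x y = - bracket y x.
Proof.
have := bracketxx (x + y); rewrite bracketDl !linearD /= !bracketxx.
by rewrite add0r addr0 => /eqP; rewrite addr_eq0 => /eqP.
Qed.

Lemma bracket_coordDl u u' v :
  bracket_coord (u + u') v = bracket_coord u v + bracket_coord u' v.
Proof. by have := bracket_coord_linear_l v 1 u u'; rewrite /= !scale1r. Qed.

Lemma bracket_coord0l v : bracket_coord 0 v = 0.
Proof.
by apply: (addrI (bracket_coord 0 v)); rewrite -bracket_coordDl !addr0.
Qed.

Lemma pure_coord_sum a I (r : seq I) (F : I -> L) :
  pure_coord a (\sum_(i <- r) F i) = \sum_(i <- r) pure_coord a (F i).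
Proof. exact: (big_morph _ (pure_coordD a) (pure_coord0 a)). Qed.

Lemma pure_coord_scale a c x : pure_coord a (c *: x) = pure_coord (c *: a) x.
Proof. by apply/rowP => i; rewrite !mxE linearZ /= scalerA mulrC. Qed.

Lemma bracket_pure_coord a b x y :
  bracket_coord (pure_coord a x) (pure_coord b y)
    = pure_coord (a * b) (bracket x y).
Proof.
rewrite {2}(coord_vbasis (memvf x)) {2}(coord_vbasis (memvf y)).
rewrite (big_morph (bracket^~ _) (id1 := 0) (op1 := +%R)); first last.
- by have := bracketZl 0 0 (\sum_i coord e i y *: e`_i); rewrite !scale0r.
- by move=> ? ?; exact: bracketDl.
rewrite pure_coord_sum; apply: eq_bigr => i _.
rewrite linear_sum pure_coord_sum; apply: eq_bigr => j _ /=.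
rewrite bracketZr bracketZl !pure_coord_scale [RHS]pure_coordZ !mxE.
by rewrite -scalerAl -scalerAr scalerA -?scalerA.
Qed.

Lemma bracket_coordC u v : bracket_coord u v = - bracket_coord v u.
Proof.
rewrite /bracket_coord exchange_big /= -sumrN; apply: eq_bigr => i _.
rewrite -sumrN; apply: eq_bigr => j _.
rewrite mulrC -scalerN; congr (_ *: _); rewrite bracketC.
by apply/rowP => l; rewrite !mxE raddfN scaleNr.
Qed.

Lemma bracket_coordxx u : bracket_coord u u = 0.
Proof.
rewrite (coord_decomp u); elim/big_rec: _ => [|i v _ IH].
  exact: bracket_coord0l.
rewrite bracket_coordDl !linearD /= IH addr0 bracket_pure_coord bracketxx.
by rewrite pure_coord0 add0r bracket_coordC addNr.
Qed.

Definition jacobi_coord (u v w : M) : M :=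
  bracket_coord u (bracket_coord v w) + bracket_coord v (bracket_coord w u)
    + bracket_coord w (bracket_coord u v).

Lemma jacobi_coord_rot u v w : jacobi_coord u v w = jacobi_coord v w u.
Proof. by rewrite /jacobi_coord addrC addrA addrC addrA. Qed.

Lemma jacobi_coordD u u' v w :
  jacobi_coord (u + u') v w = jacobi_coord u v w + jacobi_coord u' v w.
Proof.
rewrite /jacobi_coord !bracket_coordDl !linearD /= -!addrA.
congr (_ + _); rewrite addrCA; congr (_ + _).
by rewrite [RHS]addrCA; congr (_ + _); rewrite addrCA.
Qed.

Lemma jacobi_coord_ind v w :
  (forall a x, jacobi_coord (pure_coord a x) v w = 0) ->
  forall u, jacobi_coord u v w = 0.
Proof.
move=> J0 u; rewrite (coord_decomp u); elim/big_rec: _ => [|i u' _ IH].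
  by have := J0 0 0; rewrite pure_coord0.
by rewrite jacobi_coordD J0 IH addr0.
Qed.

Lemma bracket_coord_jacobi u v w : jacobi_coord u v w = 0.
Proof.
move: u; apply: jacobi_coord_ind => a x; rewrite jacobi_coord_rot.
move: v; apply: jacobi_coord_ind => b y; rewrite jacobi_coord_rot.
move: w; apply: jacobi_coord_ind => c z; rewrite jacobi_coord_rot.
rewrite /jacobi_coord !bracket_pure_coord.
have -> : b * (c * a) = a * (b * c) by rewrite mulrA mulrC.
have -> : c * (a * b) = a * (b * c) by rewrite mulrC mulrA.
by rewrite -!pure_coordD bracket_jacobi pure_coord0.
Qed.

HB.instance Definition _ := Lmodule_isLieAlgebra.Build K M
  bracket_coord_linear_l bracket_coord_linear_r bracket_coordxx
  bracket_coord_jacobi.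

Lemma scalar_ext_coordP : is_lie_scalar_extension pure_coord.
Proof.
split; last exact: bracket_pure_coord.
split=> [||W f f_l f_r]; [exact: pure_coord_linear_l|exact: pure_coord_linear_r|].
have fDl v a b : f (a + b) v = f a v + f b v.
  by have := f_l v 1 a b; rewrite /= !scale1r.
have f0l v : f 0 v = 0 by apply: (addrI (f 0 v)); rewrite -fDl !addr0.
have fZl v c a : f (c *: a) v = c *: f a v.
  by have := f_l v c a 0; rewrite /= f0l !addr0.
have fDr a v w : f a (v + w) = f a v + f a w.
  by have := f_r a 1 v w; rewrite /= !scale1r.
have f0r a : f a 0 = 0 by apply: (addrI (f a 0)); rewrite -fDr !addr0.
have fZr a c v : f a (c *: v) = c *: f a v.
  by have := f_r a c v 0; rewrite /= f0r !addr0.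
exists (fun u : M => \sum_i f ((u : 'rV_n) 0 i) e`_i); split=> [|h [h_lin hf]].
  split=> [c u u'|a v].
    rewrite scaler_sumr -big_split; apply: eq_bigr => i _ /=.
    by rewrite !mxE fDl mulr_algl fZl.
  rewrite {2}(coord_vbasis (memvf v)) (big_morph (f a) (fDr a) (f0r a)).
  by apply: eq_bigr => i _; rewrite !mxE fZl fZr.
have hD u u' : h (u + u') = h u + h u'.
  by have := h_lin 1 u u'; rewrite !scale1r.
have h0 : h 0 = 0 by apply: (addrI (h 0)); rewrite -hD !addr0.
apply: funext => u; rewrite {2}(coord_decomp u) (big_morph h hD h0).
by apply: eq_bigr => i _; rewrite hf.
Qed.

End Coordinates.

(* Main.v *)
Require Import Defs.
From HB Require Import structures.
From mathcomp Require Import all_boot all_algebra all_field.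
From mathcomp Require Import boolp classical_sets.

(** The idea is to slice a [K]-linear derivation into [k]-linear ones.  A
    [k]-linear form [l] on [K] gives the contraction
    [l (x) id : K (x) gk -> gk].  It commutes with bracketing by an element
    [1 (x) x], because such a bracket does not touch the factor [K]
    ([contraction_bracket]).  So, for [D] in [AID gK], the map
    [x |-> (l (x) id) (D (1 (x) x))] is again a derivation, and it is again
    almost inner: if [D (1 (x) x) = [y, 1 (x) x]], then it sends [x] to
    [[(l (x) id) y, x]] ([slice_AID]).

    Let [l] range over the coordinate forms of a basis [b] of [K] over [k].  If
    [AID gk = Inn gk], the slices of [D] are [ad (z i)] for some [z i] in [gk].
    Since an element of [gK] is the sum of [b i] times its [i]-th contraction
    ([contraction_decomp]), [D] and the inner derivation of
    [\sum_i b i (x) z i] agree on [1 (x) gk].  This subspace spans [gK] over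
    [K], so [D] is inner. *)

Set Implicit Arguments.
Unset Strict Implicit.
Unset Printing Implicit Defensive.

Import GRing.Theory.
Local Open Scope ring_scope.

Lemma Inn_sub_AID (F : fieldType) (L : lieAlgType F) :
  (Inn L `<=` AID L)%classic.
Proof.
move=> _ [x _ <-]; split=> [y z|y]; last by exists x; rewrite adE.
rewrite !adE; apply/eqP; rewrite addrC -subr_eq0 opprD addrA.
have := bracket_jacobi x y z.
rewrite (bracketC z x) (bracketC z (bracket x y)) linearN /= => <-.
by rewrite -!addrA.
Qed.

(** The universal property quantifies over [k]-modules only; uniqueness of maps
    into a [K]-module is obtained from it by restricting scalars. *)
Definition restrict_scalars (k : fieldType) (K : fieldExtType k)
  (V : lmodType K) : Type := V.

Section RestrictScalars.
Variables (k : fieldType) (K : fieldExtType k) (V : lmodType K).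
Local Notation W := (restrict_scalars V).

HB.instance Definition _ := GRing.Zmodule.copy W V.

Definition restrict_scale (c : k) (v : W) : W := (c%:A : K) *: (v : V).

Fact restrict_scaleA a b v :
  restrict_scale a (restrict_scale b v) = restrict_scale (a * b) v.
Proof. by rewrite /restrict_scale scalerA mulr_algl scalerA. Qed.

Fact restrict_scale1 : left_id 1 restrict_scale.
Proof. by move=> v; rewrite /restrict_scale !scale1r. Qed.

Fact restrict_scaleDr : right_distributive restrict_scale +%R.
Proof. by move=> a u v; rewrite /restrict_scale scalerDr. Qed.

Fact restrict_scaleDl v : {morph restrict_scale^~ v : a b / a + b}.
Proof. by move=> a b; rewrite /restrict_scale !scalerDl. Qed.

HB.instance Definition _ := GRing.Zmodule_isLmodule.Build k W
  restrict_scaleA restrict_scale1 restrict_scaleDr restrict_scaleDl.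

End RestrictScalars.

Section ScalarExtensionTheory.
Variables (k : fieldType) (K : fieldExtType k).
Variables (V : lmodType k) (V' : lmodType K) (t : K -> V -> V').
Hypothesis t_ext : is_scalar_extension t.

Definition base_linear (W : lmodType k) (h : V' -> W) : Prop :=
  forall (c : k) u u', h (c%:A *: u + u') = c *: h u + h u'.

Lemma pureE a v : t a v = a *: t 1 v.
Proof.
have t0 : t 0 v = 0.
  apply: (addrI (t 0 v)); rewrite addr0.
  by have := pure_linear_l t_ext v 1 0 0; rewrite mulr0 addr0 scale1r.
by have := pure_linear_l t_ext v a 1 0; rewrite mulr1 t0 !addr0.
Qed.

(** The common restriction to pure tensors is bilinear, so the uniqueness half
    of the universal property applies to it. *)
Lemma eq_on_pure (W : lmodType k) (h h' : V' -> W) :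
    base_linear h -> base_linear h' ->
  (forall a v, h (t a v) = h' (t a v)) -> h =1 h'.
Proof.
move=> h_lin h'_lin hh' u.
have [||g [_ g_uniq]] :=
    pure_universal t_ext (W := W) (f := fun a v => h (t a v)).
- by move=> v c a b; rewrite -h_lin -(pure_linear_l t_ext) mulr_algl.
- by move=> a c v w; rewrite -h_lin -(pure_linear_r t_ext).
have -> : h = g by rewrite (g_uniq h).
by rewrite (g_uniq h') //; split=> // a v; rewrite hh'.
Qed.

Lemma eq_on_pure_restrict (W : lmodType K) (h h' : V' -> W) :
    (forall (c : k) u u', h (c%:A *: u + u') = c%:A *: h u + h u') ->
    (forall (c : k) u u', h' (c%:A *: u + u') = c%:A *: h' u + h' u') ->
  (forall a v, h (t a v) = h' (t a v)) -> h =1 h'.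
Proof. exact: (@eq_on_pure (restrict_scalars W)). Qed.

Lemma eq_on_pure1 (W : lmodType K) (f g : {linear V' -> W}) :
  (forall v, f (t 1 v) = g (t 1 v)) -> f =1 g.
Proof.
move=> fg; apply: eq_on_pure_restrict => [c u u'|c u u'|a v].
- by rewrite linearP.
- by rewrite linearP.
by rewrite pureE !linearZ /= fg.
Qed.

(** The map [l (x) id]; the universal property determines it from [l]. *)
Definition is_contraction (l : K -> k) (h : V' -> V) : Prop :=
  base_linear h /\ forall a v, h (t a v) = l a *: v.

Lemma contraction_exists (l : {linear K -> k^o}) :
  exists h, is_contraction l h.
Proof.
have [||h [hP _]] := pure_universal t_ext (W := V) (f := fun a v => l a *: v).
- by move=> v c a b; rewrite linearP scalerDl scalerA.
- by move=> a c v w; rewrite scalerDr !scalerA mulrC.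
by exists h.
Qed.

(** Both sides are [k]-linear in [u], and for [u = t a v] the equation says that
    [a] is the combination of the basis given by its coordinates. *)
Lemma contraction_decomp n (b : n.-tuple K) (h : 'I_n -> V' -> V) :
    basis_of fullv b -> (forall i, is_contraction (coord b i) (h i)) ->
  forall u, u = \sum_(i < n) b`_i *: t 1 (h i u).
Proof.
move=> b_basis hP; apply: (@eq_on_pure_restrict _ id) => // [c u u'|a v].
  rewrite scaler_sumr -big_split; apply: eq_bigr => i _ /=.
  have [-> _] := hP i.
  by rewrite (pure_linear_r t_ext) scalerDr !scalerA mulrC.
rewrite [LHS]pureE {1}(coord_basis b_basis (memvf a)) scaler_suml.
apply: eq_bigr => i _; have [_ ht] := hP i.
have t10 : t 1 0 = 0.
  have := pure_linear_r t_ext 1 (-1) 0 0.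
  by rewrite scaler0 addr0 !scaleN1r addNr.
have := pure_linear_r t_ext 1 (coord b i a) v 0.
by rewrite ht t10 !addr0 => ->; rewrite scalerA mulr_algr.
Qed.

End ScalarExtensionTheory.

Section Slices.
Variables (k : fieldType) (K : fieldExtType k).
Variables (L : lieAlgType k) (L' : lieAlgType K) (t : K -> L -> L').
Hypothesis t_ext : is_lie_scalar_extension t.

Let t_lin := lie_scalar_extension t_ext.

(** On a pure tensor, [l (x) id] maps [a (x) [y, x]] to
    [l a *: [y, x]], which is the bracket of [l a *: y] with [x]. *)
Lemma contraction_bracket l h : is_contraction t l h ->
  forall u x, h (bracket u (t 1 x)) = bracket (h u) x.
Proof.
move=> [h_lin ht] u x.
apply: (eq_on_pure t_lin (h := fun u => h (bracket u (t 1 x)))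
                         (h' := fun u => bracket (h u) x)).
- by move=> c v w; rewrite bracketDl bracketZl h_lin.
- by move=> c v w; rewrite h_lin bracketDl bracketZl.
by move=> a y; rewrite (pure_bracket t_ext) mulr1 !ht bracketZl.
Qed.

(** An almost inner derivation gives, for each [x], a [y] in [L'] with
    [D (t 1 x) = [y, t 1 x]]; the contraction of [y] is the element of [L] that
    witnesses almost innerness of the slice at [x]. *)
Lemma slice_AID l h (D : 'End(L')) : is_contraction t l h -> AID L' D ->
  exists2 E : 'End(L), AID L E & forall x, E x = h (D (t 1 x)).
Proof.
move=> hP [D_der D_ai]; have [h_lin _] := hP.
pose s x := h (D (t 1 x)).
have s_lin : linear s.
  by move=> c x y; rewrite /s (pure_linear_r t_lin) linearP h_lin.
pose sL : {linear L -> L} := HB.pack s (GRing.isLinear.Build k L L *:%R s s_lin).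
have sE x : linfun sL x = h (D (t 1 x)) by rewrite lfunE.
exists (linfun sL) => //; split=> [x y|x]; rewrite !sE.
  have -> : t 1 (bracket x y) = bracket (t 1 x) (t 1 y).
    by rewrite (pure_bracket t_ext) mulr1.
  have hD u v : h (u + v) = h u + h v.
    by have := h_lin 1 u v; rewrite !scale1r.
  have hN u : h (- u) = - h u.
    have h0 : h 0 = 0 by apply: (addrI (h 0)); rewrite -hD !addr0.
    by apply: (addrI (h u)); rewrite -hD !subrr.
  rewrite D_der hD (contraction_bracket hP) (bracketC (t 1 x)) hN.
  by rewrite (contraction_bracket hP) -bracketC.
have [y ->] := D_ai (t 1 x).
by exists (h y); rewrite (contraction_bracket hP).
Qed.

(** If the slice of [D] along the [i]-th coordinate form is [ad (z i)], then
    reassembling the slices shows that [D] is [ad (\sum_i b i (x) z i)]. *)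
Lemma AID_sub_Inn_ext :
  (AID L `<=` Inn L)%classic -> (AID L' `<=` Inn L')%classic.
Proof.
move=> AID_Inn D D_AID; pose b := vbasis {:K}.
have /choice[h hP] i : exists h, is_contraction t (coord b i) h.
  exact: contraction_exists.
have /choice[z zP] i : exists z, forall x, h i (D (t 1 x)) = bracket z x.
  have [E /AID_Inn[z _ <-] Es] := slice_AID (hP i) D_AID.
  by exists z => x; rewrite -Es adE.
exists (\sum_(i < \dim {:K}) b`_i *: t 1 (z i)) => //.
apply/lfunP; apply: (eq_on_pure1 t_lin) => x /=; rewrite adE.
rewrite [RHS](contraction_decomp t_lin (vbasisP _) hP) bracketC linear_sum.
rewrite -sumrN; apply: eq_bigr => i _ /=.
by rewrite zP linearZ /= -scalerN -bracketC (pure_bracket t_ext) mulr1.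
Qed.

End Slices.

Theorem proposition6p6 (k : fieldType) (char0 : [pchar k] =i pred0)
    (K : fieldExtType k) (gk : lieAlgType k)
    (gK : lieAlgType K) (pure : K -> gk -> gK)
    (gK_ext : is_lie_scalar_extension pure) :
  AID gK <> Inn gK -> AID gk <> Inn gk.
Proof.
move=> AID_neq AID_eq; apply: AID_neq.
apply/seteqP; split; last exact: Inn_sub_AID.
by apply: (AID_sub_Inn_ext gK_ext); rewrite AID_eq.
Qed.
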